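(* Let $h>1$ be a fixed integer. For any integer $d$ such that $h\leq d\leq 2h-1$, and for $F\in\mathbb{C}[x_0,x_1]_d$ a general homogeneous polynomial of degree $d$ in two variables, we have $$VSP(F,h)\cong\mathbb{P}^{2h-d-1}.$$
   Context: The base field is $\mathbb{C}$. An unordered set of points $\{[L_1],\ldots,[L_h]\}\subset(\mathbb{P}^1)^*$, with $L_i\in\mathbb{C}[x_0,x_1]_1$ linear forms, is a polar $h$-polyhedron of $F\in\mathbb{C}[x_0,x_1]_d$ if $F=\lambda_1L_1^d+\cdots+\lambda_hL_h^d$ for some nonzero scalars $\lambda_1,\ldots,\lambda_h\in\mathbb{C}$ and the forms $L_1^d,\ldots,L_h^d$ are linearly independent in $\mathbb{C}[x_0,x_1]_d$. $VSP(F,h)^o$ denotes the set of all polar $h$-polyhedra of $F$, and $VSP(F,h):=\overline{VSP(F,h)^o}\subseteq\mathrm{Hilb}_h((\mathbb{P}^1)^* )$ is its closure in the Hilbert scheme of length $h$ zero-dimensional subschemes. ''General'' means outside a proper Zariski closed subset of the parameter space. *)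

(* Defs.v *)
From HB Require Import structures.
From mathcomp Require Import all_boot all_order all_algebra.
From mathcomp Require Export mpoly.
From mathcomp Require Export complex reals.

Set Implicit Arguments.
Unset Strict Implicit.
Unset Printing Implicit Defensive.
Import GRing.Theory.
Local Open Scope ring_scope.

(* P(V) is the set of lines of V.  Polynomial functions on V are polynomials  *)
(* in the coordinates of a vector in the basis vbasis {:V}; another basis     *)
(* changes them by an invertible linear substitution, which affects neither   *)
(* the Zariski topology nor regularity.                                       *)
Definition proj (K : fieldType) (V : vectType K) : predArgType :=
  {l : {vspace V} | \dim l == 1%N}.

Definition polyeval (K : fieldType) (V : vectType K)
    (f : {mpoly K[\dim {:V}]}) (v : V) : K :=
  f.@[fun i => coord (vbasis {:V}) i v].

(* Closed subsets of the affine space V. *)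
Definition affine_closed (K : fieldType) (V : vectType K) (Z : V -> Prop) :
    Prop :=
  exists S : {mpoly K[\dim {:V}]} -> Prop,
    forall v, Z v <-> (forall f, S f -> polyeval f v = 0).

Definition general (K : fieldType) (V : vectType K) (P : V -> Prop) : Prop :=
  exists Z : V -> Prop,
    [/\ affine_closed Z, exists v, ~ Z v & forall v, ~ Z v -> P v].

Definition vanishes (K : fieldType) (V : vectType K)
    (f : {mpoly K[\dim {:V}]}) (p : proj V) : Prop :=
  forall v, v \in val p -> polyeval f v = 0.

Definition proj_closed (K : fieldType) (V : vectType K) (Z : proj V -> Prop) :
    Prop :=
  exists S : {mpoly K[\dim {:V}]} -> Prop,
    (forall f, S f -> exists e : nat, f \is e.-homog) /\
    (forall p, Z p <-> (forall f, S f -> vanishes f p)).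

Definition zariski_closure (K : fieldType) (V : vectType K)
    (X : proj V -> Prop) (p : proj V) : Prop :=
  forall Z : proj V -> Prop, proj_closed Z -> (forall q, X q -> Z q) -> Z p.

Definition polymap (K : fieldType) (V W : vectType K)
    (g : 'I_(\dim {:W}) -> {mpoly K[\dim {:V}]}) (v : V) : W :=
  \sum_j polyeval (g j) v *: (vbasis {:W})`_j.

(* Morphisms between subvarieties X of P(V) and Y of P(W) (with their reduced *)
(* structure): maps that, on an open neighbourhood of each point of X, are    *)
(* given by homogeneous polynomials of one degree with no common zero there.  *)
(* The values of f outside X are irrelevant.                                  *)
Definition regular_map (K : fieldType) (V W : vectType K)
    (X : proj V -> Prop) (Y : proj W -> Prop) (f : proj V -> proj W) : Prop :=
  (forall x, X x -> Y (f x)) /\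
  (forall x, X x ->
   exists (Z : proj V -> Prop) (e : nat)
          (g : 'I_(\dim {:W}) -> {mpoly K[\dim {:V}]}),
     [/\ proj_closed Z, ~ Z x, forall j, g j \is e.-homog
       & forall y, X y -> ~ Z y -> forall v, v \in val y -> v != 0 ->
           polymap g v != 0 /\ polymap g v \in val (f y)]).

Definition isomorphic (K : fieldType) (V W : vectType K)
    (X : proj V -> Prop) (Y : proj W -> Prop) : Prop :=
  exists (f : proj V -> proj W) (g : proj W -> proj V),
    [/\ regular_map X Y f, regular_map Y X g,
        forall x, X x -> g (f x) = x & forall y, Y y -> f (g y) = y].

Definition proj_space (K : fieldType) (n : nat) (_ : proj 'rV[K]_n.+1) : Prop :=
  True.
Arguments proj_space : clear implicits.

(* K[x_0, x_1]_d.  In particular (P^1)^* is proj (binary_form K 1), and the   *)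
(* class of a linear form L is the line <[L]>.                                *)
Notation binary_form K d := (dhomog 2 K d).

Lemma power_homog (K : fieldType) (d : nat) (L : binary_form K 1) :
  (L : {mpoly K[2]}) ^+ d \is d.-homog.
Proof. by rewrite -{2}[d]mul1n; apply: dhomogMn; apply: dhomog_is_dhomog. Qed.

Definition power (K : fieldType) (d : nat) (L : binary_form K 1) :
    binary_form K d :=
  DHomog (power_homog d L).

(* For d > 0, freeness forces the L_i to be nonzero with distinct classes. *)
Definition polar_polyhedron (K : fieldType) (d h : nat) (F : binary_form K d)
    (A : proj (binary_form K 1) -> Prop) : Prop :=
  exists (L : 'I_h -> binary_form K 1) (lambda : 'I_h -> K),
    [/\ forall i, lambda i != 0,
        F = \sum_i lambda i *: power d (L i),
        free [tuple power d (L i) | i < h]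
      & forall p, A p <-> exists i, val p = <[L i]>%VS].

(* The homogeneous coordinate ring of (P^1)^* is again {mpoly K[2]}; its      *)
(* variables are now the two coefficients of a linear form.                   *)
Definition dual_eval (K : fieldType) (f : {mpoly K[2]}) (L : binary_form K 1) :
    K :=
  f.@[fun i => (L : {mpoly K[2]})@_U_(i)].

(* Homogeneous since each p in A is a whole line and K is infinite. *)
Definition vanishing_ideal (K : fieldType) (A : proj (binary_form K 1) -> Prop)
    (f : {mpoly K[2]}) : Prop :=
  forall p, A p -> forall L, L \in val p -> dual_eval f L = 0.

Definition homogeneous_ideal (K : fieldType) (I : {mpoly K[2]} -> Prop) :
    Prop :=
  [/\ I 0, forall f g, I f -> I g -> I (f + g),
      forall f g, I g -> I (f * g)
    & forall f (k : nat), I f -> I (pihomog mdeg k f)].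

Definition saturated (K : fieldType) (I : {mpoly K[2]} -> Prop) : Prop :=
  forall (N : nat) (f : {mpoly K[2]}),
    (forall q : {mpoly K[2]}, q \is N.-homog -> I (q * f)) -> I f.

Definition graded_piece (K : fieldType) (I : {mpoly K[2]} -> Prop) (k : nat)
    (U : {vspace binary_form K k}) : Prop :=
  forall f : binary_form K k, f \in U <-> I f.

Definition hilbert_polynomial_cst (K : fieldType) (I : {mpoly K[2]} -> Prop)
    (h : nat) : Prop :=
  exists k0 : nat, forall k, (k0 <= k)%N ->
    exists U : {vspace binary_form K k},
      graded_piece I U /\ (\dim U + h)%N = \dim {:binary_form K k}.

(* Closed subschemes of (P^1)^* of length h correspond to saturated           *)
(* homogeneous ideals I with Hilbert polynomial h.  These are h-regular, so   *)
(* I |-> I_h is Grothendieck's closed embedding of Hilb_h((P^1)^* ) in the    *)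
(* Grassmannian of subspaces of codimension h of the (h+1)-dimensional space  *)
(* binary_form K h, that is, in proj (binary_form K h).                       *)
Definition Hilb (K : fieldType) (h : nat) (p : proj (binary_form K h)) : Prop :=
  exists I : {mpoly K[2]} -> Prop,
    [/\ homogeneous_ideal I, saturated I, hilbert_polynomial_cst I h
      & graded_piece I (val p)].

(* A polyhedron A is the point of Hilb given by the reduced subscheme A. *)
Definition VSPo (K : fieldType) (d : nat) (F : binary_form K d)
    (h : nat) (p : proj (binary_form K h)) : Prop :=
  exists A, polar_polyhedron h F A /\ graded_piece (vanishing_ideal A) (val p).

Definition VSP (K : fieldType) (d : nat) (F : binary_form K d)
    (h : nat) (p : proj (binary_form K h)) : Prop :=
  Hilb p /\ zariski_closure (@VSPo K d F h) p.
Arguments VSP : clear implicits.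
Arguments VSP {K d} F h p.

(* Main.v *)
Require Import Defs.
From HB Require Import structures.
From mathcomp Require Import all_boot all_order all_algebra.
From mathcomp Require Import separable zify ring.
Set Implicit Arguments.
Unset Strict Implicit.
Unset Printing Implicit Defensive.
Import GRing.Theory Num.Theory.
Local Open Scope ring_scope.

(** The theorem is apolarity for binary forms.  Write
    F = sum_k C(d,k) c_k x0^(d-k) x1^k.  A form f = sum_j f_j a^(h-j) b^j of
    degree h in the coefficients (a, b) of a linear form is apolar to F when
    sum_j f_j c_(i+j) = 0 for 0 <= i <= d-h; these f form a linear subspace
    apolar h F of the forms of degree h.  A point of the Hilbert scheme is the
    class of a nonzero form f of degree h, namely the divisor f = 0 (every
    such class occurs, Hilb_line), and for general F the variety VSP(F,h) is
    exactly the projective space of apolar h F.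

    One inclusion holds for every F: if F is a combination of the L_i^d, a form
    f vanishing at the L_i is apolar to F (VSPo_apolar), and this is a closed
    condition.  Conversely, let f be apolar to F, with h distinct roots
    y_1, ..., y_h in the affine chart a = 1.  The c_k satisfy the linear
    recurrence with characteristic polynomial f(1,y), so
    c_k = sum_i lambda_i y_i^k for k <= d (power_sums_of_recurrence), which
    says that F = sum_i lambda_i (x0 + y_i x1)^d.  The coefficient lambda_i is
    nonzero as soon as y_i is not a root of the associated polynomial
    phi(y) = sum_k c_k (polynomial part of f(y)/y^(k+1)), because
    phi(y_i) = lambda_i f'(y_i).  Hence <f> is a polar polyhedron unless the
    polynomial nondegeneracy in f and the c_k vanishes: it is the product of
    the leading coefficient of f, of a Sylvester determinant of f and f', and
    of one of f and phi (apolar_VSPo).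

    If some f0 apolar to F is nondegenerate, a homogeneous polynomial that
    vanishes on the polar polyhedra vanishes at the nondegenerate points of
    each line through f0 in apolar h F, which are all but finitely many of
    them, hence on the whole of apolar h F (apolar_closure).

    It remains to find such an f0 for general F.  Cramer's rule for the Hankel
    matrix (c_(i+j)) gives an element f0 of apolar h F whose coefficients are
    polynomials in the c_k (hankel_solution).  So the required conditions on F,
    that a maximal minor of the Hankel matrix and the nondegeneracy of f0 are
    nonzero, define an open set; the minor being nonzero also gives
    dim (apolar h F) = 2h-d.  This open set contains the F with c_0 = c_h = 1
    and all other c_k = 0, where f0 is proportional to 1 - y^h and phi to
    y^(h-1) (nondegeneracy_special). *)

(** * Binary forms and their coefficients *)

(** The exponent of x0^(d-i) x1^i, meaningful for i <= d. *)
Definition bimon (d i : nat) : 'X_{1..2} :=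
  [multinom (if k == ord0 then (d - i)%N else i) | k < 2].

Lemma ord2 (k : 'I_2) : (k = ord0) \/ (k = ord_max).
Proof. by case: k => [[|[|k]] Hk] //; [left|right]; apply/val_inj. Qed.

Lemma bimon0 d i : bimon d i ord0 = (d - i)%N.
Proof. by rewrite mnmE. Qed.

Lemma bimon1 d i : bimon d i ord_max = i.
Proof. by rewrite mnmE. Qed.

Lemma mdeg2 (m : 'X_{1..2}) : mdeg m = (m ord0 + m ord_max)%N.
Proof.
rewrite mdegE big_ord_recl big_ord1; congr (_ + m _)%N; exact/val_inj.
Qed.

Lemma mdeg_bimon d i : (i <= d)%N -> mdeg (bimon d i) = d.
Proof. by move=> le_id; rewrite mdeg2 bimon0 bimon1 subnK. Qed.

Lemma bimonP (m : 'X_{1..2}) : bimon (mdeg m) (m ord_max) = m.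
Proof.
apply/mnmP => k; case: (ord2 k) => ->; rewrite ?bimon0 ?bimon1 //.
by rewrite mdeg2 addnK.
Qed.

Lemma bimon_inj d i j : bimon d i = bimon d j -> i = j.
Proof. by move=> eq_ij; rewrite -(bimon1 d i) eq_ij bimon1. Qed.

Section BinaryForms.
Variable K : fieldType.
Implicit Types (d : nat) (f : {mpoly K[2]}).

(** The form sum_i a_i x0^(d-i) x1^i, as a polynomial and as an element of the
    space of binary forms of degree d. *)
Definition form_of d (a : nat -> K) : {mpoly K[2]} :=
  \sum_(i < d.+1) a i *: 'X_[bimon d i].

Lemma form_of_homog d a : form_of d a \is d.-homog.
Proof.
apply: rpred_sum => i _; apply: rpredZ.
by rewrite dhomogX /= mdeg_bimon // -ltnS.
Qed.

Definition bform d a : binary_form K d := DHomog (form_of_homog d a).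

Lemma mcoeff_form_of d a i : (i <= d)%N -> (form_of d a)@_(bimon d i) = a i.
Proof.
move=> le_id; rewrite /form_of raddf_sum /= (bigD1 (inord i)) //= big1.
  by rewrite mcoeffZ mcoeffX inordK // eqxx mulr1 addr0.
move=> j ne_ji; rewrite mcoeffZ mcoeffX; case: eqP => [/bimon_inj eq_ji|_].
  by case/eqP: ne_ji; apply/val_inj; rewrite /= inordK.
by rewrite mulr0.
Qed.

Lemma homog2E d f : f \is d.-homog -> f = form_of d (fun i => f@_(bimon d i)).
Proof.
move=> hf; apply/mpolyP => m; have [dm|ndm] := eqVneq (mdeg m) d.
  rewrite -(bimonP m) dm mcoeff_form_of //.
  by rewrite -dm mdeg2 leq_addl.
by rewrite (dhomog_nemf_coeff hf ndm) (dhomog_nemf_coeff (form_of_homog _ _)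
  ndm).
Qed.

Lemma homog2_inj d f g : f \is d.-homog -> g \is d.-homog ->
  (forall i, (i <= d)%N -> f@_(bimon d i) = g@_(bimon d i)) -> f = g.
Proof.
move=> hf hg eq_fg; rewrite (homog2E hf) (homog2E hg).
by apply: eq_bigr => i _; rewrite eq_fg // -ltnS.
Qed.

Lemma bform_inj d (f g : binary_form K d) :
  (forall i, (i <= d)%N -> (f : {mpoly K[2]})@_(bimon d i) =
    (g : {mpoly K[2]})@_(bimon d i)) ->
  f = g.
Proof.
move=> eq_fg; apply: val_inj.
by apply: (@homog2_inj d _ _ _ _ eq_fg); apply: dhomog_is_dhomog.
Qed.

Lemma prod_ord2 (v : 'I_2 -> K) (m : 'X_{1..2}) :
  \prod_(i < 2) v i ^+ m i = v ord0 ^+ m ord0 * v ord_max ^+ m ord_max.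
Proof.
rewrite big_ord_recl big_ord1; congr (_ * v _ ^+ m _); exact/val_inj.
Qed.

Lemma meval2 d f (v : 'I_2 -> K) : f \is d.-homog ->
  f.@[v] = \sum_(i < d.+1) f@_(bimon d i) * (v ord0 ^+ (d - i) *
    v ord_max ^+ i).
Proof.
move=> hf; rewrite {1}(homog2E hf) raddf_sum /=; apply: eq_bigr => i _.
by rewrite mevalZ mevalX prod_ord2 bimon0 bimon1.
Qed.

Lemma linear_formE (L : binary_form K 1) : 
  (L : {mpoly K[2]}) = (L : {mpoly K[2]})@_(U_(ord0))%MM *: 'X_ord0 +
    (L : {mpoly K[2]})@_(U_(ord_max))%MM *: 'X_ord_max.
Proof.
have e0 : bimon 1 0 = U_(ord0)%MM.
  by apply/mnmP => k; case: (ord2 k) => ->; rewrite ?bimon0 ?bimon1 mnm1E.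
have e1 : bimon 1 1 = U_(ord_max)%MM.
  by apply/mnmP => k; case: (ord2 k) => ->; rewrite ?bimon0 ?bimon1 mnm1E.
rewrite {1}(homog2E (dhomog_is_dhomog L)) /form_of big_ord_recl big_ord1.
by rewrite /= /bump /= e0 e1.
Qed.

Lemma mcoeff_power d (L : binary_form K 1) i : (i <= d)%N ->
  (power d L : {mpoly K[2]})@_(bimon d i) =
  ((L : {mpoly K[2]})@_(U_(ord0))%MM ^+ (d - i) *
    (L : {mpoly K[2]})@_(U_(ord_max))%MM ^+ i) *+ 'C(d, i).
Proof.
move=> le_id; rewrite /=; have := linear_formE L.
set a := _@_ _; set b := _@_ _ => ->.
have -> : (a *: 'X_ord0 + b *: 'X_ord_max) ^+ d =
   form_of d (fun i => (a ^+ (d - i) * b ^+ i) *+ 'C(d, i)) :> {mpoly K[2]}.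
  rewrite exprDn; apply: eq_bigr => j _;
    rewrite !exprZn -scalerAl -scalerAr scalerA.
  rewrite -scalerMnl; congr (_ *: _ *+ _).
  rewrite !mpolyXn -mpolyXD; congr 'X_[_]; apply/mnmP => k.
  by case: (ord2 k) => ->;
    rewrite mnmDE !mulmnE !mnm1E ?bimon0 ?bimon1 /= ?mul1n ?muln1 ?mul0n ?muln0
      ?addn0.
by rewrite mcoeff_form_of.
Qed.

End BinaryForms.

(** * Sylvester determinants, linear recurrences and power sums *)

Section Sylvester.
Variable A : comNzRingType.

(** The matrix whose rows are the coefficients of X^i p and X^i q for i < n; it
    is meant for p and q of degree at most n.  Both blocks have n rows, so that
    its determinant detects common roots also when q has degree less than n:
    only the degree of p has to be exactly n. *)
Definition sylvester n (p q : {poly A}) : 'M[A]_(n + n) :=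
  col_mx (\matrix_(i < n, k < n + n) ('X^i * p)`_k)
         (\matrix_(i < n, k < n + n) ('X^i * q)`_k).

(** The polynomial obtained by applying the functional z^a |-> c_a to
    (g(y) - g(z)) / (y - z), for g of degree at most n. *)
Definition associated n (g : {poly A}) (c : nat -> A) : {poly A} :=
  \sum_(j < n.+1) \sum_(a < j) (g`_j * c a) *: 'X^(j.-1 - a).

(** For n > 0 and g of degree at most n over an algebraically closed field, it
    is nonzero exactly when g has degree n, simple roots, and no common root
    with its associated polynomial.  It is defined over any ring because it is
      evaluated along
    lines and for generic coefficients. *)
Definition nondegeneracy n (g : {poly A}) (c : nat -> A) : A :=
  g`_n * \det (sylvester n g g^`()) * \det (sylvester n g (associated n g c)).

Lemma size_associated n g c : (size (associated n g c) <= n)%N.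
Proof.
apply: (leq_trans (size_sum _ _ _)); apply/bigmax_leqP => j _.
apply: (leq_trans (size_sum _ _ _)); apply/bigmax_leqP => a _.
apply: (leq_trans (size_scale_leq _ _)); rewrite size_polyXn.
by have := ltn_ord j; have := ltn_ord a; lia.
Qed.

Lemma horner_associated n g c x :
  (associated n g c).[x] = \sum_(j < n.+1) g`_j *
    \sum_(a < j) x ^+ (j.-1 - a) * c a.
Proof.
rewrite horner_sum; apply: eq_bigr => j _; rewrite horner_sum mulr_sumr.
by apply: eq_bigr => a _; rewrite hornerZ hornerXn -mulrA [c a * _]mulrC.
Qed.

End Sylvester.

Section Morphism.
Variables (A B : comNzRingType) (f : {rmorphism A -> B}).

Lemma map_sylvester n p q :
  map_mx f (sylvester n p q) = sylvester n (map_poly f p) (map_poly f q).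
Proof.
rewrite map_col_mx; congr col_mx; apply/matrixP => i k;
  by rewrite !mxE -coef_map rmorphM /= map_polyXn.
Qed.

Lemma map_associated n g c :
  map_poly f (associated n g c) = associated n (map_poly f g) (f \o c).
Proof.
rewrite rmorph_sum; apply: eq_bigr => j _; rewrite rmorph_sum.
apply: eq_bigr => a _ /=.
by rewrite map_polyZ rmorphM /= map_polyXn coef_map.
Qed.

Lemma map_nondegeneracy n g c :
  f (nondegeneracy n g c) = nondegeneracy n (map_poly f g) (f \o c).
Proof.
rewrite /nondegeneracy !rmorphM /= -!det_map_mx !map_sylvester map_associated.
by rewrite deriv_map coef_map.
Qed.

End Morphism.

Section Field.
Variable K : fieldType.
Implicit Types (p q g : {poly K}).

Lemma sylvester_root n p q x : (0 < n)%N -> (size p <= n.+1)%N ->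
  (size q <= n.+1)%N -> root p x -> root q x -> \det (sylvester n p q) = 0.
Proof.
move=> n_gt0 sp sq px qx; apply/eqP; apply: contraT => ndet.
have szX (r : {poly K}) (i : 'I_n) : (size r <= n.+1)%N ->
  (size ('X^i * r)%R <= n + n)%N.
  move=> sr; apply: (leq_trans (size_polyMleq _ _)); rewrite size_polyXn.
  by have := ltn_ord i; lia.
have U : sylvester n p q \in unitmx by rewrite unitmxE unitfE.
pose u : 'cV[K]_(n + n) := \col_k x ^+ k.
have block (r : {poly K}) : (size r <= n.+1)%N -> root r x ->
  (\matrix_(i < n, k < n + n) ('X^i * r)`_k) *m u = 0.
  move=> sr /eqP rx; apply/matrixP => i j; rewrite !mxE.
  transitivity (('X^i * r).[x]); last by rewrite hornerM rx mulr0.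
  rewrite (horner_coef_wide _ (szX r i sr)).
  by apply: eq_bigr => k _; rewrite !mxE.
have Su : sylvester n p q *m u = 0 by rewrite mul_col_mx !block ?col_mx0.
have /matrixP/(_ (Ordinal (ltn_addr n n_gt0)) 0) : u = 0.
  by rewrite -(mulKmx U u) Su mulmx0.
by rewrite !mxE expr0 => /eqP; rewrite oner_eq0.
Qed.

Lemma sylvester_coprime n p q : size p = n.+1 -> (size q <= n)%N ->
  coprimep p q -> \det (sylvester n p q) != 0.
Proof.
move=> sp sq cpq; apply/negP => /det0P [v nz_v vS].
pose u := rVpoly (lsubmx v); pose w := rVpoly (rsubmx v).
have comb (t : 'rV[K]_n) (r : {poly K}) k (lt_k : (k < n + n)%N) :
  (t *m (\matrix_(i < n, k < n + n) ('X^i * r)`_k)) 0 (Ordinal lt_k) =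
    (rVpoly t * r)`_k.
  rewrite !mxE /rVpoly poly_def mulr_suml coef_sum; apply: eq_bigr => i _.
  by rewrite !mxE -scalerAl coefZ /= insubT //= => lt_i; congr (t _ _ * _);
    apply/val_inj.
have size_rV (t : 'rV[K]_n) : (size (rVpoly t) <= n)%N by apply: size_poly.
have uw0 : u * p + w * q = 0.
  apply/polyP => k; rewrite coef0 coefD; case: (ltnP k (n + n)) => lt_k.
    move/matrixP/(_ 0 (Ordinal lt_k)): vS.
    by rewrite -{1}(hsubmxK v) mul_row_col mxE !comb mxE.
  have bound (r s : {poly K}) : (size r <= n)%N -> (size s <= n.+1)%N ->
      (size (r * s)%R <= k)%N.
    move=> sr ss; apply: (leq_trans (size_polyMleq _ _)).
    by rewrite -subn1 leq_subLR; apply: (leq_trans (leq_add sr ss)); lia.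
  by rewrite !nth_default ?addr0 ?bound ?sp ?size_rV // leqW.
have p_w : p %| w.
  rewrite -(Gauss_dvdpl _ cpq); apply/dvdpP; exists (- u).
  by rewrite mulNr; apply/eqP; rewrite -addr_eq0 addrC uw0.
have w0 : w = 0.
  apply/eqP; apply: contraT => nz_w; have := dvdp_leq nz_w p_w.
  by rewrite sp => /leq_trans/(_ (size_rV _)); rewrite ltnn.
have nz_p : p != 0 by rewrite -size_poly_eq0 sp.
have u0 : u = 0.
  by move/eqP: uw0; rewrite w0 mul0r addr0 mulf_eq0 (negPf nz_p) orbF => /eqP.
case/eqP: nz_v; rewrite -(hsubmxK v) -[lsubmx v]rVpolyK -[rsubmx v]rVpolyK.
by rewrite -/u -/w u0 w0 !linear0 row_mx0.
Qed.

Lemma vandermonde_unit n (y : 'I_n -> K) : injective y ->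
  Vandermonde n (\row_j y j) \in unitmx.
Proof.
move=> inj_y; rewrite unitmxE unitfE det_Vandermonde.
apply/prodf_neq0 => i _; apply/prodf_neq0 => j lt_ij; rewrite !mxE subr_eq0.
by apply: contraTneq lt_ij => /inj_y ->; rewrite ltnn.
Qed.

Lemma power_sums_free n (y : 'I_n -> K) (mu : 'I_n -> K) : injective y ->
  (forall k, (k < n)%N -> \sum_i mu i * y i ^+ k = 0) -> forall i, mu i = 0.
Proof.
move=> /vandermonde_unit U mu0 i.
have /matrixP/(_ i 0) : \col_i mu i = 0 :> 'cV_n; last by rewrite !mxE.
rewrite -(mulKmx U (\col_i mu i)); set t := _ *m \col_i _.
suff -> : t = 0 by rewrite mulmx0.
apply/matrixP => k j; rewrite !mxE -[RHS](mu0 k (ltn_ord k)).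
by apply: eq_bigr => l _; rewrite !mxE mulrC.
Qed.

(** A sequence satisfying the linear recurrence with characteristic polynomial
    g is a combination of the powers of the roots of g, when these are
    distinct: the combination is determined on the first n terms by a
    Vandermonde system, and the recurrence propagates it. *)
Lemma power_sums_of_recurrence n d g (y : 'I_n -> K) (c : nat -> K) :
  (n <= d.+1)%N ->
  size g = n.+1 -> injective y -> (forall i, root g (y i)) ->
  (forall i, (i + n <= d)%N -> \sum_(j < n.+1) g`_j * c (i + j)%N = 0) ->
  exists lambda : 'I_n -> K,
    forall k, (k <= d)%N -> c k = \sum_i lambda i * y i ^+ k.
Proof.
move=> le_nd sg inj_y gy rec.
have U := vandermonde_unit inj_y.
pose l := invmx (Vandermonde n (\row_j y j)) *m \col_(k < n) c k.
exists (fun i => l i 0) => k; elim/ltn_ind: k => k IH le_kd.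
case: (ltnP k n) => [lt_kn|le_nk].
  have /matrixP/(_ (Ordinal lt_kn) 0) := mulKVmx U (\col_(k < n) c k).
  rewrite -/l !mxE /= => <-.
  by apply: eq_bigr => i _; rewrite !mxE mulrC.
have nz_g : g`_n != 0.
  by have := lead_coef_eq0 g; rewrite lead_coefE sg /= => ->;
    rewrite -size_poly_eq0 sg.
apply: (mulfI nz_g).
have := rec (k - n)%N; rewrite subnK // => /(_ le_kd).
rewrite big_ord_recr /= subnK // => /eqP; rewrite addrC addr_eq0 => /eqP ->.
rewrite (eq_bigr (fun j : 'I_n => \sum_i g`_j * (l i 0 *
  y i ^+ (k - n + j)%N))); last first.
  by move=> j _; rewrite IH ?mulr_sumr //; have := ltn_ord j; lia.
rewrite exchange_big /= mulr_sumr -sumrN; apply: eq_bigr => i _.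
have /eqP := gy i; rewrite horner_coef sg big_ord_recr /= => /eqP.
rewrite addrC addr_eq0 => /eqP E.
rewrite mulrCA -{2}(subnK le_nk) exprD [y i ^+ _ * _]mulrC [g`_n * _]mulrA E.
rewrite mulNr mulrN mulr_suml mulr_sumr; congr (- _); apply: eq_bigr => j _.
by rewrite exprD mulrCA -!mulrA; congr (_ * (_ * _)); rewrite mulrC.
Qed.

(** The value of the associated polynomial at y_i is lambda_i g'(y_i): the terms
    with l <> i are lambda_l (g(y_i) - g(y_l)) / (y_i - y_l) = 0. *)
Lemma associated_power_sums n g (y lambda : 'I_n -> K) (c : nat -> K) i :
  (size g <= n.+1)%N -> injective y -> (forall j, root g (y j)) ->
  (forall k, (k < n)%N -> c k = \sum_j lambda j * y j ^+ k) ->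
  lambda i = 0 -> root (associated n g c) (y i).
Proof.
move=> sg inj_y gy Ec l0; rewrite /root horner_associated.
rewrite (eq_bigr (fun j : 'I_n.+1 => \sum_l lambda l *
    (g`_j * \sum_(a < j) y i ^+ (j.-1 - a) * y l ^+ a))); last first.
  move=> j _; rewrite (eq_bigr (fun a : 'I_j => \sum_l lambda l *
    (y i ^+ (j.-1 - a) * y l ^+ a))).
    rewrite exchange_big /= mulr_sumr; apply: eq_bigr => l _.
    by rewrite -mulr_sumr mulrCA.
  move=> a _; rewrite Ec; last by have := ltn_ord j; have := ltn_ord a; lia.
  by rewrite mulr_sumr; apply: eq_bigr => l _; rewrite mulrCA.
rewrite exchange_big /= big1 // => l _; rewrite -mulr_sumr.
have [->|ne_li] := eqVneq l i; first by rewrite l0 mul0r.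
rewrite [X in _ * X](_ : _ = 0) ?mulr0 //.
have nz : y i - y l != 0 by rewrite subr_eq0 (inj_eq inj_y) eq_sym.
apply: (mulfI nz); rewrite mulr0 mulr_sumr.
rewrite (eq_bigr (fun j : 'I_n.+1 => g`_j * y i ^+ j - g`_j * y l ^+ j));
  last first.
  move=> j _; rewrite mulrCA -mulrBr; congr (_ * _); rewrite subrXX //.
rewrite sumrB -!(horner_coef_wide _ sg).
by move/eqP: (gy i) => ->; move/eqP: (gy l) => ->; rewrite subrr.
Qed.

End Field.

(** * Polynomial functions, closed sets and linear isomorphisms *)

Section PolyFun.
Variables (K : fieldType) (V : vectType K).
Implicit Types (f : {mpoly K[\dim {:V}]}) (v w : V).

(** The restriction of f to the line t |-> v + t w. *)
Definition on_line f v w : {poly K} :=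
  mmap polyC (fun i => (coord (vbasis {:V}) i v)%:P +
                       coord (vbasis {:V}) i w *: 'X) f.

Lemma horner_on_line f v w t : (on_line f v w).[t] = polyeval f (v + t *: w).
Proof.
rewrite /on_line /polyeval /mmap mevalE horner_sum; apply: eq_bigr => m _.
rewrite hornerM hornerC /mmap1 horner_prod; congr (_ * _).
apply: eq_bigr => i _; rewrite horner_exp hornerD hornerC hornerZ hornerX.
by rewrite linearD linearZ /= mulrC.
Qed.

Lemma polyeval_homog e f v a : f \is e.-homog ->
  polyeval f (a *: v) = a ^+ e * polyeval f v.
Proof.
move=> hf; rewrite /polyeval !mevalE mulr_sumr.
apply: eq_big_seq => m /(dhomog_mf hf) me; rewrite mulrCA; congr (_ * _).
rewrite -[e]me /= mdegE -prodrXr -big_split /=; apply: eq_bigr => i _.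
by rewrite linearZ /= exprMn.
Qed.

(** The linear form theta as a polynomial in the coordinates. *)
Definition linear_mpoly (theta : {linear V -> K^o}) : {mpoly K[\dim {:V}]} :=
  \sum_(i < \dim {:V}) theta (vbasis {:V})`_i *: 'X_i.

Lemma linear_mpoly_homog theta : linear_mpoly theta \is 1.-homog.
Proof.
by apply: rpred_sum => i _; apply: rpredZ; rewrite dhomogX /= mdeg1.
Qed.

Lemma polyeval_linear_mpoly theta v : polyeval (linear_mpoly theta) v = theta v.
Proof.
rewrite /polyeval /linear_mpoly raddf_sum [in RHS](coord_vbasis (memvf v))
  linear_sum.
by apply: eq_bigr => i _; rewrite /= mevalZ mevalXU linearZ mulrC.
Qed.

Lemma proj_line_subproof v : v != 0 -> \dim <[v]>%VS == 1%N.
Proof. by rewrite dim_vline => ->. Qed.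

(** The point of P(V) given by a nonzero vector. *)
Definition proj_line v (nz : v != 0) : proj V :=
  exist (fun l : {vspace V} => \dim l == 1%N) <[v]>%VS (proj_line_subproof nz).

Lemma projP (p : proj V) : exists v, v != 0 /\ val p = <[v]>%VS.
Proof.
case: p => l /= dl; exists (vpick l).
have nz : vpick l != 0 by rewrite vpick0 -dimv_eq0 (eqP dl).
split=> //; apply/esym/eqP.
by rewrite eqEdim -memvE memv_pick dim_vline nz (eqP dl).
Qed.

Lemma vanishes_line e f v (p : proj V) : f \is e.-homog -> val p = <[v]>%VS ->
  vanishes f p <-> polyeval f v = 0.
Proof.
move=> hf pv; split=> [|f0 w]; first by apply; rewrite pv memv_line.
by rewrite pv => /vlineP [a ->]; rewrite (polyeval_homog _ _ hf) f0 mulr0.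
Qed.

Lemma proj_closed_subspace (W : {vspace V}) :
  proj_closed (fun p : proj V => (val p <= W)%VS).
Proof.
(* W is the common kernel of the coordinates of v - projv W v. *)
have lin i : linear (fun v => coord (vbasis {:V}) i (v - projv W v) : K^o).
  move=> a v w; rewrite [projv W _]linearP opprD addrACA -scalerN -scalerDr.
  by rewrite linearP.
pose theta i : {linear V -> K^o} :=
  HB.pack (fun v => coord (vbasis {:V}) i (v - projv W v) : K^o)
    (GRing.isLinear.Build _ _ _ _ _ (lin i)).
exists (fun f => exists i, f = linear_mpoly (theta i)); split.
  by move=> _ [i ->]; exists 1%N; apply: linear_mpoly_homog.
move=> p; split=> [/subvP pW _ [i ->] v /pW Wv|van].
  by rewrite polyeval_linear_mpoly /= projv_id // subrr linear0.
apply/subvP => v pv; have : v - projv W v = 0; last first.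
  by move/eqP; rewrite subr_eq0 => /eqP ->; apply: memv_proj.
rewrite (coord_vbasis (memvf (v - projv W v))) big1 // => i _.
have := van _ (ex_intro _ i erefl) _ pv; rewrite polyeval_linear_mpoly /= => ->.
by rewrite scale0r.
Qed.

Lemma proj_closed_empty : proj_closed (fun _ : proj V => False).
Proof.
exists (fun f => f = 1); split=> [f ->|p]; first by exists 0%N; apply: dhomog1.
split=> // /(_ 1 erefl); case: (projP p) => v [_ pv] /(_ v).
by rewrite pv memv_line /polyeval meval1 => /(_ erefl)/eqP; rewrite oner_eq0.
Qed.

End PolyFun.

(** A map of projective varieties induced by a linear map that has no zero on
    the source is regular. *)
Lemma regular_linear (K : fieldType) (V W : vectType K) (X : proj V -> Prop)
    (Y : proj W -> Prop) (u : 'Hom(V, W)) (f : proj V -> proj W) :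
  (forall x, X x -> Y (f x)) ->
  (forall x v, X x -> v \in val x -> v != 0 -> u v != 0 /\ u v \in val (f x)) ->
  regular_map X Y f.
Proof.
move=> XY fu; split=> // x Xx.
have lin j : linear (fun v => coord (vbasis {:W}) j (u v) : K^o).
  by move=> a v w; rewrite !linearP.
pose theta j : {linear V -> K^o} :=
  HB.pack (fun v => coord (vbasis {:W}) j (u v) : K^o)
    (GRing.isLinear.Build _ _ _ _ _ (lin j)).
exists (fun _ => False), 1%N, (fun j => linear_mpoly (theta j)); split=> //.
- exact: proj_closed_empty.
- by move=> j; apply: linear_mpoly_homog.
move=> y Xy _ v yv nz; rewrite /polymap.
rewrite (eq_bigr (fun j => coord (vbasis {:W}) j (u v) *: (vbasis {:W})`_j)).
  by rewrite -coord_vbasis ?memvf //; apply: fu.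
by move=> j _; rewrite polyeval_linear_mpoly.
Qed.

Lemma isomorphic_subspace (K : fieldType) (V : vectType K) (n : nat)
    (W : {vspace V}) (X : proj V -> Prop) :
  \dim W = n.+1 -> (forall p, X p <-> (val p <= W)%VS) ->
  isomorphic X (proj_space K n).
Proof.
move=> dW XW.
pose b (i : 'I_n.+1) := (vbasis W)`_i.
pose u0 (v : V) : 'rV[K]_n.+1 := \row_i coord (vbasis W) (cast_ord (esym dW) i)
  v.
pose w0 (r : 'rV[K]_n.+1) : V := \sum_i r 0 i *: b i.
have lu : linear u0 by move=> a v w; apply/rowP => i; rewrite !mxE linearP.
have lw : linear w0.
  move=> a r s; rewrite /w0 scaler_sumr -big_split /=; apply: eq_bigr => i _.
  by rewrite !mxE scalerDl scalerA.
pose lu' : {linear V -> 'rV[K]_n.+1} :=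
  HB.pack u0 (GRing.isLinear.Build _ _ _ _ _ lu).
pose lw' : {linear 'rV[K]_n.+1 -> V} :=
  HB.pack w0 (GRing.isLinear.Build _ _ _ _ _ lw).
pose u := linfun lu'; pose w := linfun lw'.
have uE v : u v = u0 v by rewrite lfunE.
have wE r : w r = w0 r by rewrite lfunE.
have fW := basis_free (vbasisP W).
have bW i : b i \in W.
  by apply: (basis_mem (vbasisP W)); rewrite mem_nth // size_tuple dW.
have wW r : w r \in W by rewrite wE; apply: rpred_sum => i _; apply: rpredZ.
have uwK r : u (w r) = r.
  rewrite uE wE; apply/rowP => i; rewrite mxE linear_sum (bigD1 i) //= big1
    ?addr0.
    by rewrite linearZ /= -[in b i](cast_ordK (esym dW) i) coord_free // eqxx
      mulr1.
  move=> j ne_ji; rewrite linearZ /= /b.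
  rewrite [(vbasis W)`_j](_ : _ = (vbasis W)`_(cast_ord (esym dW) j)) //
    coord_free //.
  by rewrite (inj_eq (@cast_ord_inj _ _ _)) ?[i == j]eq_sym (negPf ne_ji) /=
    mulr0.
have wuK v : v \in W -> w (u v) = v.
  move=> Wv; rewrite wE uE [RHS](coord_vbasis Wv) /w0.
  rewrite (reindex (cast_ord dW)) /=; last first.
    by exists (cast_ord (esym dW)) => i _; rewrite ?cast_ordK ?cast_ordKV.
  by apply: eq_bigr => i _; rewrite mxE cast_ordK.
have nzb : b ord0 != 0.
  by apply: (free_not0 fW); rewrite mem_nth // size_tuple dW.
have nz1 : (const_mx 1 : 'rV[K]_n.+1) != 0.
  by apply/eqP => /rowP/(_ ord0); rewrite !mxE => /eqP; rewrite oner_eq0.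
(* Off P(W) the image may fail to be a line; the value there is irrelevant. *)
pose f (p : proj V) : proj 'rV[K]_n.+1 :=
  insubd (proj_line nz1) (u @: val p)%VS.
pose g (p : proj 'rV[K]_n.+1) : proj V :=
  insubd (proj_line nzb) (w @: val p)%VS.
have nzu v : v \in W -> v != 0 -> u v != 0.
  by move=> Wv; apply: contraNneq => uv0; rewrite -(wuK v Wv) uv0 linear0.
have nzw r : r != 0 -> w r != 0.
  by apply: contraNneq => wr0; rewrite -(uwK r) wr0 linear0.
have fE x : X x -> val (f x) = (u @: val x)%VS.
  move=> /XW xW; rewrite /f val_insubd; case: (projP x) => v [nz xv].
  rewrite xv limg_line dim_vline nzu //.
  by rewrite xv -memvE in xW.
have gE y : val (g y) = (w @: val y)%VS.
  rewrite /g val_insubd; case: (projP y) => r [nz yr].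
  by rewrite yr limg_line dim_vline nzw.
exists f, g; split.
- apply: (@regular_linear _ _ _ _ _ u) => // x v Xx xv nz.
  rewrite fE // memv_img // nzu //; exact: (subvP (proj1 (XW x) Xx)).
- apply: (@regular_linear _ _ _ _ _ w) => [y _|y r _ yr nz].
    by apply/XW; rewrite gE; apply/subvP => _ /memv_imgP [r _ ->].
  by rewrite gE memv_img // nzw.
- move=> x Xx; apply: val_inj; rewrite gE fE //.
  case: (projP x) => v [nz xv]; rewrite xv !limg_line wuK //.
  by move/XW: Xx; rewrite xv -memvE.
move=> y _; apply: val_inj; rewrite fE ?gE.
  by case: (projP y) => r [nz yr]; rewrite yr !limg_line uwK.
by apply/XW; rewrite gE; apply/subvP => _ /memv_imgP [r _ ->].
Qed.

(** * The Hilbert scheme of points of the projective line *)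

Lemma dim_binary_form (K : fieldType) d : \dim {:binary_form K d} = d.+1.
Proof. by rewrite dimvf [LHS](_ : _ = 'C(d + 1, d)) // addn1 binSn. Qed.

Section Principal.
Variable K : fieldType.
Implicit Types (f g q : {mpoly K[2]}).

Lemma pihomog_mulr h k g q : g \is h.-homog ->
  exists2 r, r \is (k - h).-homog & pihomog mdeg k (q * g) = r * g.
Proof.
move=> hg; pose E := mmeasure mdeg q.
exists (\sum_(e < E | (e + h)%N == k) pihomog mdeg e q).
  apply: rpred_sum => e /eqP <-; rewrite addnK; exact: pihomogP.
rewrite {1}(@pihomog_partitionE _ _ mdeg E q) // mulr_suml raddf_sum /=
  mulr_suml.
rewrite [RHS]big_mkcond /=; apply: eq_bigr => e _.
have hm : pihomog mdeg e q * g \is (e + h)%N.-homog.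
  by apply: dhomogM => //; exact: pihomogP.
case: eqP => [<-|/eqP ne]; first by rewrite pihomog_dE.
by rewrite (pihomog_ne0 ne hm).
Qed.

Lemma mcoeff_mulX_eq0 k m f : ~~ (k <= m)%MM -> ('X_[k] * f)@_m = 0.
Proof.
move=> nle; rewrite [f]mpolyE mulr_sumr raddf_sum big1 //= => m' _.
rewrite -scalerAr mcoeffZ -mpolyXD mcoeffX; case: eqP => [E|];
  last by rewrite mulr0.
by rewrite -E lem_addr in nle.
Qed.

(** The variables form a regular sequence; this is what makes principal ideals
    saturated. *)
Lemma mpolyX_dvd (i j : 'I_2) N f g : i != j ->
  'X_[U_(j) *+ N] * f = 'X_[U_(i) *+ N] * g ->
    exists c, f = 'X_[U_(i) *+ N] * c.
Proof.
move=> ne_ij E.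
exists (\sum_(m <- msupp f) f@_m *: 'X_[m - U_(i) *+ N]).
rewrite {1}[f]mpolyE mulr_sumr; apply: eq_big_seq => m f_m.
rewrite -scalerAr -mpolyXD; case: (boolP (U_(i) *+ N <= m)%MM) => [le_m|nle].
  by rewrite addmC submK.
have : ('X_[U_(j) *+ N] * f)@_(U_(j) *+ N + m) = 0.
  rewrite E mcoeff_mulX_eq0 //; apply: contra nle => /mnm_lepP le.
  apply/mnm_lepP => l; have := le l; rewrite mnmDE !mulmnE !mnm1E.
  case: (eqVneq i l) => [<-|_]; last by rewrite mul0n.
  by rewrite eq_sym (negPf ne_ij) mul0n add0n.
rewrite mulrC mcoeffMX => fm0.
by move: f_m; rewrite mcoeff_msupp fm0 eqxx.
Qed.

Variables (h : nat) (g : {mpoly K[2]}).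
Hypotheses (hg : g \is h.-homog) (nz_g : g != 0).

(** The ideal generated by g. *)
Definition principal f : Prop := exists q, f = q * g.

Lemma principal_homogeneous : homogeneous_ideal principal.
Proof.
split.
- by exists 0; rewrite mul0r.
- by move=> _ _ [q ->] [r ->]; exists (q + r); rewrite mulrDl.
- by move=> f _ [q ->]; exists (f * q); rewrite mulrA.
by move=> _ k [q ->]; case: (pihomog_mulr k q hg) => r _ ->; exists r.
Qed.

Lemma principal_saturated : saturated principal.
Proof.
move=> N f If.
have hX i : ('X_[U_(i) *+ N] : {mpoly K[2]}) \is N.-homog.
  by rewrite dhomogX /= mdegMn mdeg1 mul1n.
have [a Ea] := If _ (hX ord0); have [b Eb] := If _ (hX ord_max).
have [|c Ec] := @mpolyX_dvd ord0 ord_max N a b isT.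
  by apply: (mulIf nz_g); rewrite -!mulrA -Ea -Eb mulrCA.
exists c; apply: (mulfI (_ : 'X_[U_(ord0) *+ N] != 0));
  last by rewrite Ea Ec mulrA.
by rewrite -msupp_eq0 msuppX.
Qed.

(** Multiplication by g is injective, so its image in degree k has dimension
    (k-h)+1, that is, codimension h. *)
Lemma principal_piece k : (h <= k)%N ->
  exists U : {vspace binary_form K k},
    graded_piece principal U /\ (\dim U + h)%N = \dim {:binary_form K k}.
Proof.
move=> le_hk.
have hm (q : binary_form K (k - h)) : (q : {mpoly K[2]}) * g \is k.-homog.
  by rewrite -{2}(subnK le_hk); apply: dhomogM => //; apply: dhomog_is_dhomog.
pose m (q : binary_form K (k - h)) : binary_form K k := DHomog (hm q).
have lm : linear m.
  by move=> a p q; apply: val_inj; rewrite /= mulrDl -scalerAl.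
pose lm' : {linear binary_form K (k - h) -> binary_form K k} :=
  HB.pack m (GRing.isLinear.Build _ _ _ _ _ lm).
exists (limg (linfun lm')); split=> [f|].
  split=> [/memv_imgP [q _ ->]|[q Eq]]; first by rewrite lfunE;
    exists (q : {mpoly K[2]}).
  have [r hr Er] := pihomog_mulr k q hg.
  apply/memv_imgP; exists (DHomog hr); first exact: memvf.
  rewrite lfunE; apply: val_inj; rewrite /= -Er -Eq pihomog_dE //.
  exact: dhomog_is_dhomog.
rewrite limg_dim_eq ?dim_binary_form; first by lia.
apply/eqP; rewrite -subv0; apply/subvP => q.
rewrite memv_cap memvf memv_ker lfunE memv0 /= => /eqP E.
have /eqP : (q : {mpoly K[2]}) * g = 0 by have := congr1 val E.
by rewrite mulf_eq0 (negPf nz_g) orbF => /eqP E0; apply/eqP/val_inj.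
Qed.

End Principal.

(** The class of a nonzero form g of degree h is the point of the Hilbert scheme
    given by the ideal of g. *)
Lemma Hilb_line (K : fieldType) (h : nat) (p : proj (binary_form K h)) : Hilb p.
Proof.
case: (projP p) => g [nz pg].
have hg : (g : {mpoly K[2]}) \is h.-homog by exact: dhomog_is_dhomog.
have nz_g : (g : {mpoly K[2]}) != 0.
  by apply: contraNneq nz => E; apply/eqP/val_inj.
exists (principal (g : {mpoly K[2]})); split.
- exact: principal_homogeneous hg.
- exact: principal_saturated.
- by exists h => k; apply: principal_piece.
move=> f; rewrite pg; split=> [/vlineP [a ->]|[q Eq]].
  by exists a%:MP; rewrite /= mul_mpolyC.
have [r hr Er] := pihomog_mulr h q hg.
have Ef : (f : {mpoly K[2]}) = r * g.
  by rewrite -Er -Eq pihomog_dE //; exact: dhomog_is_dhomog.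
apply/vlineP; exists (r@_0%MM); apply: val_inj; rewrite /= Ef.
rewrite -mul_mpolyC; congr (_ * _); apply/mpolyP => m; rewrite mcoeffC.
case: eqP => [->|/eqP nm]; first by rewrite mulr1.
rewrite mulr0 (dhomog_nemf_coeff hr) //= subnn mdeg_eq0 //.
Qed.

(** * Apolar forms and polar polyhedra *)

Section Apolarity.
Variable K : numClosedFieldType.

(** The coefficient of x0^(d-i) x1^i in f. *)
Definition form_coef d (i : nat) (f : binary_form K d) : K :=
  (f : {mpoly K[2]})@_(bimon d i).

(** The coefficients c_k with F = sum_k C(d,k) c_k x0^(d-k) x1^k, so that c_k is
    a^(d-k) b^k for F = (a x0 + b x1)^d. *)
Definition divided_coef d (F : binary_form K d) (k : nat) : K :=
  form_coef k F / 'C(d, k)%:R.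

(** The polynomial f(1, X). *)
Definition dehomogenize d (f : binary_form K d) : {poly K} :=
  \poly_(i < d.+1) form_coef i f.

Lemma form_coefD d i (f g : binary_form K d) :
  form_coef i (f + g) = form_coef i f + form_coef i g.
Proof. exact: mcoeffD. Qed.

Lemma form_coefZ d i a (f : binary_form K d) :
  form_coef i (a *: f) = a * form_coef i f.
Proof. exact: mcoeffZ. Qed.

Lemma form_coef_sum d i (I : Type) (r : seq I) (F : I -> binary_form K d) :
  form_coef i (\sum_(l <- r) F l) = \sum_(l <- r) form_coef i (F l).
Proof. by rewrite /form_coef linear_sum raddf_sum. Qed.

Lemma form_coef_bform d i a : (i <= d)%N -> form_coef i (bform d a) = a i.
Proof. exact: mcoeff_form_of. Qed.

Lemma bin_neq0 d k : (k <= d)%N -> 'C(d, k)%:R != 0 :> K.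
Proof. by move=> le_kd; rewrite pnatr_eq0 -lt0n bin_gt0. Qed.

Lemma divided_coef_linear d k :
  linear (fun F : binary_form K d => divided_coef F k : K^o).
Proof.
by move=> a F G; rewrite /divided_coef form_coefD form_coefZ mulrDl -mulrA.
Qed.

Lemma divided_coef_inj d (F G : binary_form K d) :
  (forall k, (k <= d)%N -> divided_coef F k = divided_coef G k) -> F = G.
Proof.
move=> eqFG; apply: bform_inj => i le_id.
have nz : ('C(d, i)%:R^-1 : K) != 0 by rewrite invr_eq0 bin_neq0.
exact: (mulIf nz (eqFG i le_id)).
Qed.

Lemma divided_coef_power_sum d n (lambda : 'I_n -> K) (L : 'I_n ->
  binary_form K 1) k :
  (k <= d)%N ->
  divided_coef (\sum_l lambda l *: power d (L l)) k =
  \sum_l lambda l * ((L l : {mpoly K[2]})@_(U_(ord0))%MM ^+ (d - k) *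
                     (L l : {mpoly K[2]})@_(U_(ord_max))%MM ^+ k).
Proof.
move=> le_kd; rewrite /divided_coef form_coef_sum mulr_suml;
  apply: eq_bigr => l _.
rewrite form_coefZ /form_coef mcoeff_power // -mulr_natr -!mulrA.
by rewrite divff ?bin_neq0 // mulr1.
Qed.

(** Up to a nonzero factor, the coefficients, for 0 <= i <= d-h, of the form of
    degree d-h obtained by letting f act on F as a differential operator. *)
Definition contraction d h (F : binary_form K d) (i : nat) (f :
  binary_form K h) : K :=
  \sum_(j < h.+1) form_coef j f * divided_coef F (i + j).

Definition contractions d h (F : binary_form K d) (f : binary_form K h) :
    'rV[K]_((d - h).+1) :=
  \row_i contraction F i f.

Lemma contractions_linear d h (F : binary_form K d) :
  linear (@contractions d h F).
Proof.
move=> a f g; apply/rowP => i; rewrite !mxE mulr_sumr -big_split /=.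
by apply: eq_bigr => j _; rewrite form_coefD form_coefZ mulrDl -mulrA.
Qed.

HB.instance Definition _ d h F :=
  GRing.isLinear.Build K (binary_form K h) 'rV[K]_((d - h).+1) _
    (@contractions d h F) (@contractions_linear d h F).

(** For h <= d, the forms of degree h annihilating F. *)
Definition apolar d h (F : binary_form K d) : {vspace binary_form K h} :=
  lker (linfun (@contractions d h F)).

Lemma apolarP d h (F : binary_form K d) (f : binary_form K h) : (h <= d)%N ->
  reflect (forall i, (i + h <= d)%N ->
    contraction F i f = 0) (f \in apolar h F).
Proof.
move=> le_hd; rewrite memv_ker lfunE /=; apply: (iffP eqP) => [E i le_i|E].
  have lt_i : (i < (d - h).+1)%N by lia.
  by move/rowP/(_ (Ordinal lt_i)): E; rewrite !mxE.
by apply/rowP => i; rewrite !mxE E //; have := ltn_ord i; lia.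
Qed.

Lemma dual_evalE h (f : binary_form K h) (L : binary_form K 1) :
  dual_eval f L = \sum_(j < h.+1) form_coef j f *
    ((L : {mpoly K[2]})@_(U_(ord0))%MM ^+ (h - j) *
     (L : {mpoly K[2]})@_(U_(ord_max))%MM ^+ j).
Proof. by rewrite /dual_eval (meval2 _ (dhomog_is_dhomog f)). Qed.

Lemma VSPo_apolar d h (F : binary_form K d) (p : proj (binary_form K h)) :
  (0 < d)%N -> (h <= d)%N -> VSPo F p -> (val p <= apolar h F)%VS.
Proof.
move=> d_gt0 le_hd [A [[L [lambda [_ -> freeL AL]]] pA]].
apply/subvP => f /pA fA; apply/apolarP => // i le_i.
have fL l : dual_eval f (L l) = 0.
  (* The vanishing ideal is tested on lines, so L l has to span one. *)
  have nz : L l != 0.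
    apply: contraTneq freeL => Ll0; apply/negP => /free_not0/(_ (_ :
      power d (L l) \in _)).
    case/(_ _)/negP.
      by apply/tnthP; exists l; rewrite tnth_mktuple.
    apply/eqP/val_inj; rewrite /= Ll0 /=; case: (d) d_gt0 => // d' _.
    by rewrite exprS mul0r.
  apply: (fA (proj_line nz)); last by rewrite memv_line.
  by apply/AL; exists l.
rewrite /contraction.
rewrite (eq_bigr (fun j : 'I_h.+1 => \sum_l lambda l *
  ((L l : {mpoly K[2]})@_(U_(ord0))%MM ^+ (d - h - i) *
   (L l : {mpoly K[2]})@_(U_(ord_max))%MM ^+ i) *
  (form_coef j f * ((L l : {mpoly K[2]})@_(U_(ord0))%MM ^+ (h - j) *
     (L l : {mpoly K[2]})@_(U_(ord_max))%MM ^+ j)))).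
  rewrite exchange_big big1 //= => l _;
    rewrite -mulr_sumr -dual_evalE fL mulr0 //.
move=> j _; have lt_j := ltn_ord j.
rewrite divided_coef_power_sum; last by lia.
rewrite mulr_sumr; apply: eq_bigr => l _.
rewrite (_ : d - (i + j) = (d - h - i) + (h - j))%N; last by lia.
rewrite !exprD; set a := _ ^+ (d - h - i); set b := _ ^+ (h - j).
set c := _ ^+ i; set e := _ ^+ j; set u := form_coef j f.
by ring.
Qed.

Lemma size_dehomogenize h (f : binary_form K h) :
  (size (dehomogenize f) <= h.+1)%N.
Proof. exact: size_poly. Qed.

Lemma coef_dehomogenize h (f : binary_form K h) i : (i <= h)%N ->
  (dehomogenize f)`_i = form_coef i f.
Proof. by move=> le_ih; rewrite coef_poly ltnS le_ih. Qed.

Lemma dehomogenize_inj h : injective (@dehomogenize h).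
Proof.
move=> f g E; apply: bform_inj => i le_ih.
by have := coef_dehomogenize f le_ih; rewrite E coef_dehomogenize.
Qed.

(** The linear form x0 + y x1. *)
Definition point_form (y : K) : binary_form K 1 :=
  bform 1 (fun k => if k == 0%N then 1 else y).

Lemma point_form0 y : (point_form y : {mpoly K[2]})@_(U_(ord0))%MM = 1.
Proof.
rewrite (_ : U_(ord0)%MM = bimon 1 0) ?mcoeff_form_of //.
by apply/mnmP => k; case: (ord2 k) => ->; rewrite ?bimon0 ?bimon1 mnm1E.
Qed.

Lemma point_form1 y : (point_form y : {mpoly K[2]})@_(U_(ord_max))%MM = y.
Proof.
rewrite (_ : U_(ord_max)%MM = bimon 1 1) ?mcoeff_form_of //.
by apply/mnmP => k; case: (ord2 k) => ->; rewrite ?bimon0 ?bimon1 mnm1E.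
Qed.

Lemma point_form_neq0 y : point_form y != 0.
Proof.
apply/eqP => E; have := point_form0 y; rewrite E /= mcoeff0 => /esym/eqP.
by rewrite oner_eq0.
Qed.

Lemma dual_eval_point h (f : binary_form K h) y a :
  dual_eval f (a *: point_form y) = a ^+ h * (dehomogenize f).[y].
Proof.
rewrite dual_evalE (horner_coef_wide _ (size_dehomogenize f)) mulr_sumr.
apply: eq_bigr => j _; rewrite !mcoeffZ point_form0 point_form1 mulr1.
have le_jh : (j <= h)%N by rewrite -ltnS.
rewrite exprMn [a ^+ (h - j) * _]mulrA -exprD subnK // coef_dehomogenize //.
by rewrite mulrCA.
Qed.

(** The converse of VSPo_apolar, for nondegenerate f: the polyhedron consists of
    the x0 + y x1 with f(1,y) = 0. *)
Lemma apolar_VSPo d h (F : binary_form K d) (f : binary_form K h)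
    (p : proj (binary_form K h)) :
  (0 < h)%N -> (h <= d)%N -> f \in apolar h F ->
  nondegeneracy h (dehomogenize f) (divided_coef F) != 0 ->
  val p = <[f]>%VS -> VSPo F p.
Proof.
move=> h_gt0 le_hd /apolarP-/(_ le_hd) apf; set g := dehomogenize f.
rewrite !mulf_eq0 !negb_or -andbA => /and3P [nz_gh det1 det2] pf.
have sg : size g = h.+1.
  apply/eqP; rewrite eqn_leq size_dehomogenize /= ltnNge.
  by apply: contra nz_gh => /leq_sizeP ->.
have nz_g : g != 0 by rewrite -size_poly_eq0 sg.
have sep : separable_poly g.
  rewrite unlock; apply: Pdiv.ClosedField.root_coprimep => x gx;
    apply: contraNneq det1 => g'x.
  apply/eqP; apply: (sylvester_root h_gt0 _ _ gx); rewrite ?sg //;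
    last exact/eqP.
  by rewrite -sg ltnW // lt_size_deriv.
have [r Eg] := closed_field_poly_normal g.
have nz_l : lead_coef g != 0 by rewrite lead_coef_eq0.
have uniq_r : uniq r.
  by rewrite -separable_prod_XsubC -(eqp_separable (eqp_scale _ nz_l)) -Eg.
have szr : size r = h.
  by move: sg; rewrite Eg size_scale // size_prod_XsubC => -[].
pose y (i : 'I_h) := nth 0 r i.
have inj_y : injective y.
  move=> i j /eqP; rewrite nth_uniq ?szr // => /eqP; exact: val_inj.
have gy i : root g (y i).
  by rewrite Eg rootZ // root_prod_XsubC mem_nth ?szr.
have rec i : (i + h <= d)%N -> \sum_(j < h.+1) g`_j *
  divided_coef F (i + j) = 0.
  move=> le_i; rewrite -[RHS](apf i le_i); apply: eq_bigr => j _.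
  by rewrite coef_dehomogenize // -ltnS.
have [lambda El] := power_sums_of_recurrence (leqW le_hd) sg inj_y gy rec.
exists (fun q => exists i, val q = <[point_form (y i)]>%VS); split.
  exists (fun i => point_form (y i)), lambda; split=> //.
  - move=> i; apply: contraNneq det2 => l0; apply/eqP.
    apply: (sylvester_root h_gt0 _ _ (gy i)); first by rewrite sg.
      exact: leqW (size_associated _ _ _).
    apply: (associated_power_sums _ inj_y gy _ l0); rewrite ?sg // => k lt_k.
    by apply: El; lia.
  - apply: divided_coef_inj => k le_k; rewrite divided_coef_power_sum // El //.
    by apply: eq_bigr => i _; rewrite point_form0 point_form1 expr1n mul1r.
  apply/freeP => mu Emu; apply: (power_sums_free inj_y) => k lt_k.
  have le_kd : (k <= d)%N by lia.
  have Emu' : \sum_i mu i *: power d (point_form (y i)) = 0.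
    move: Emu; under eq_bigr => i _ do rewrite -tnth_nth tnth_mktuple.
    exact.
  have := congr1 (fun G => divided_coef G k) Emu'.
  rewrite divided_coef_power_sum // /divided_coef /form_coef /= mcoeff0 mul0r
    => E; rewrite -[RHS]E.
  by apply: eq_bigr => i _; rewrite point_form0 point_form1 expr1n mul1r.
move=> f'; rewrite pf; split=> [/vlineP [a ->] q [i qi] L|fA].
  rewrite qi => /vlineP [b ->]; rewrite dual_eval_point.
  move/rootP: (gy i); rewrite (horner_coef_wide _ (size_dehomogenize f)) => gi.
  rewrite (horner_coef_wide _ (size_dehomogenize _)).
  rewrite (eq_bigr (fun j : 'I_h.+1 => a * (g`_j * y i ^+ j))).
    by rewrite -mulr_sumr gi !mulr0.
  move=> j _; have le_j : (j <= h)%N by rewrite -ltnS.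
  by rewrite (coef_dehomogenize (a *: f) le_j) (coef_dehomogenize f le_j)
    form_coefZ mulrA.
have f'y i : root (dehomogenize f') (y i).
  have := fA (proj_line (point_form_neq0 (y i))) (ex_intro _ i erefl) (1 *:
    point_form (y i)).
  by rewrite dual_eval_point expr1n mul1r scale1r memv_line => /(_ erefl)/eqP.
(* A form of degree h vanishing at the h points is a multiple of f. *)
have : \prod_(z <- r) ('X - z%:P) %| dehomogenize f'.
  apply: uniq_roots_dvdp; last by rewrite uniq_rootsE.
  apply/allP => z /(nthP 0) [i lt_i <-]; rewrite szr in lt_i.
  exact: (f'y (Ordinal lt_i)).
rewrite -(eqp_dvdl _ (eqp_scale _ nz_l)) -Eg => /dvdpP [q Eq].
have : (size q <= 1)%N.
  have [->|nz_q] := eqVneq q 0; first by rewrite size_poly0.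
  have := size_dehomogenize f'; rewrite Eq size_mul // sg.
  by rewrite addnS /= -[X in (_ <= X)%N]add1n leq_add2r.
move/size1_polyC => Eq1; apply/vlineP; exists (q`_0).
apply: dehomogenize_inj; rewrite Eq [in LHS]Eq1; apply/polyP => k.
rewrite coefCM !coef_poly; case: ltnP => // _; last by rewrite mulr0.
by rewrite form_coefZ.
Qed.

End Apolarity.

(** * Density of the polar polyhedra *)

Lemma poly_eq0_numdomain (R : numDomainType) (p : {poly R}) :
  (forall t, p.[t] = 0) -> p = 0.
Proof.
move=> p0; apply/eqP; apply: contraT => nz.
have := @max_poly_roots _ p [seq i%:R | i <- iota 0 (size p)] nz.
rewrite size_map size_iota ltnn => -> //.
  by apply/allP => x _; apply/rootP.
rewrite map_inj_uniq ?iota_uniq // => i j /eqP; rewrite eqr_nat => /eqP //.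
Qed.

Section Density.
Variables (K : numClosedFieldType) (d h : nat) (F : binary_form K d).
Hypotheses (h_gt0 : (0 < h)%N) (le_hd : (h <= d)%N).
Variable f0 : binary_form K h.
Hypotheses (f0W : f0 \in apolar h F)
  (f0_nondeg : nondegeneracy h (dehomogenize f0) (divided_coef F) != 0).

(** Along a line through f0 the nondegeneracy is a nonzero polynomial. *)
Lemma nondegeneracy_line (w : binary_form K h) :
  exists2 P : {poly K}, P != 0 & forall t,
    P.[t] = nondegeneracy h (dehomogenize (f0 + t *: w)) (divided_coef F).
Proof.
pose g : {poly {poly K}} :=
  \poly_(j < h.+1) ((form_coef j f0)%:P + form_coef j w *: 'X).
pose P := nondegeneracy h g (fun k => (divided_coef F k)%:P).
have PE t : P.[t] = nondegeneracy h (dehomogenize (f0 + t *: w)) (divided_coef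
  F).
  rewrite -[P.[t]]/(horner_eval t P) map_nondegeneracy.
  have -> : map_poly (horner_eval t) g = dehomogenize (f0 + t *: w).
    apply/polyP => j; rewrite coef_map !coef_poly; case: ltnP => _;
      last exact: rmorph0.
    rewrite /= /horner_eval hornerD hornerC hornerZ hornerX form_coefD
      form_coefZ.
    by rewrite [t * _]mulrC.
  congr (_ * \det (sylvester _ _ _)); apply: eq_bigr => j _;
    apply: eq_bigr => a _.
  by rewrite /= /horner_eval hornerC.
exists P => //; apply: contraNneq f0_nondeg => P0.
by have := PE 0; rewrite P0 horner0 scale0r addr0 => <-.
Qed.

Lemma nondegenerate_neq0 (f : binary_form K h) :
  nondegeneracy h (dehomogenize f) (divided_coef F) != 0 -> f != 0.
Proof.
apply: contraNneq => ->; rewrite /nondegeneracy coef_dehomogenize // /form_coef.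
by rewrite /= mcoeff0 !mul0r.
Qed.

(** The polar polyhedra are dense in P(apolar h F). *)
Lemma apolar_closure (p : proj (binary_form K h)) :
  (val p <= apolar h F)%VS -> zariski_closure (@VSPo K d F h) p.
Proof.
move=> pW Z [S [homS ZS]] VZ; apply/ZS => f Sf; have [e hf] := homS f Sf.
have [v [nz_v pv]] := projP p; apply/(vanishes_line hf pv).
have vW : v \in apolar h F by rewrite pv -memvE in pW.
have [P nz_P PE] := nondegeneracy_line (v - f0).
have : on_line f f0 (v - f0) * P = 0.
  apply: poly_eq0_numdomain => t; rewrite hornerM horner_on_line PE.
  set w := f0 + _; set b := nondegeneracy _ _ _.
  have [->|nz_b] := eqVneq b 0; first by rewrite mulr0.
  have nz_w := nondegenerate_neq0 nz_b.
  have wW : w \in apolar h F by rewrite rpredD // rpredZ // rpredB.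
  have /ZS/(_ f Sf) : Z (proj_line nz_w).
    by apply: VZ; apply: (@apolar_VSPo _ _ _ F w).
  by move/(vanishes_line (p := proj_line nz_w) hf erefl) => ->; rewrite mul0r.
move/eqP; rewrite mulf_eq0 (negPf nz_P) orbF => /eqP l0.
have := horner_on_line f f0 (v - f0) 1.
by rewrite l0 horner0 scale1r subrKC => <-.
Qed.

Lemma VSP_apolar (p : proj (binary_form K h)) :
  VSP F h p <-> (val p <= apolar h F)%VS.
Proof.
split=> [[_ clp]|pW]; last by split; [exact: Hilb_line | exact: apolar_closure].
apply: (clp (fun p => (val p <= apolar h F)%VS));
  first exact: proj_closed_subspace.
by move=> q; apply: VSPo_apolar => //; apply: leq_trans le_hd.
Qed.

End Density.

(** * Kernels of Hankel matrices by Cramer's rule *)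

Section Hankel.
Variables (A : comNzRingType) (m s : nat).
Implicit Type c : nat -> A.

(** The last m columns of the m x (s + m) Hankel matrix with entries c_(i+j). *)
Definition hankel c : 'M[A]_m := \matrix_(i, j) c (i + (s + j))%N.

(** The polynomial with coefficient \det (hankel c) in degree 0, none in degrees
    1, ..., s-1, and the other coefficients given by Cramer's rule, so that its
    coefficient vector is in the kernel of the m x (s + m) Hankel matrix. *)
Definition hankel_solution c : {poly A} :=
  (\det (hankel c))%:P -
  \sum_(j < m) ((\adj (hankel c) *m \col_i c i) j 0) *: 'X^(s + j).

Lemma size_hankel_solution c : (0 < s)%N ->
  (size (hankel_solution c) <= s + m)%N.
Proof.
move=> s_gt0; apply: (leq_trans (size_polyD _ _)); rewrite geq_max size_polyN.
apply/andP; split; first by rewrite (leq_trans (size_polyC_leq1 _)) // addn_gt0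
  s_gt0.
apply: (leq_trans (size_sum _ _ _)); apply/bigmax_leqP => j _.
apply: (leq_trans (size_scale_leq _ _)); rewrite size_polyXn.
by rewrite -addnS leq_add2l.
Qed.

Lemma hankel_solution_low c l : (0 < s)%N -> (l < s)%N ->
  (hankel_solution c)`_l = \det (hankel c) *+ (l == 0%N).
Proof.
move=> s_gt0 lt_ls; rewrite coefB coefC coef_sum big1 ?subr0.
  by case: (l == 0%N).
move=> j _; rewrite coefZ coefXn; case: eqP => [E|_]; last by rewrite mulr0.
by rewrite E ltnNge leq_addr in lt_ls.
Qed.

Lemma hankel_solution_high c (j : 'I_m) : (0 < s)%N ->
  (hankel_solution c)`_(s + j) = - (\adj (hankel c) *m \col_i c i) j 0.
Proof.
move=> s_gt0; rewrite coefB coefC addn_eq0 -[s == 0%N]negbK -lt0n s_gt0 /=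
  sub0r.
rewrite coef_sum (bigD1 j) //= big1 ?addr0;
  first by rewrite coefZ coefXn eqxx mulr1.
move=> k ne; rewrite coefZ coefXn eqn_add2l; case: eqP => [E|_];
  last by rewrite mulr0.
by case/eqP: ne; apply/val_inj.
Qed.

Lemma hankel_solutionP c (i : 'I_m) : (0 < s)%N ->
  \sum_(j < s + m) (hankel_solution c)`_j * c (i + j)%N = 0.
Proof.
move=> s_gt0; rewrite big_split_ord /=.
rewrite (bigD1 (Ordinal s_gt0)) //= big1 => [|l ne]; last first.
  by rewrite -val_eqE /= in ne; rewrite hankel_solution_low // (negPf ne)
    mulr0n mul0r.
rewrite hankel_solution_low // addn0 addr0 mulr1n.
rewrite (eq_bigr (fun j : 'I_m => - (hankel c i j *
  (\adj (hankel c) *m \col_i c i) j 0))).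
  have := congr1 (fun M : 'M[A]_m => (M *m \col_i c i) i 0) (mul_mx_adj (hankel
    c)).
  by rewrite -mulmxA mul_scalar_mx !mxE sumrN => ->; rewrite addrN.
by move=> j _; rewrite hankel_solution_high // mulNr [in RHS]mxE mulrC.
Qed.

End Hankel.

Lemma map_hankel (A B : comNzRingType) (f : {rmorphism A -> B}) m s c :
  map_mx f (hankel m s c) = hankel m s (f \o c).
Proof. by apply/matrixP => i j; rewrite !mxE. Qed.

Lemma map_hankel_solution (A B : comNzRingType) (f : {rmorphism A -> B}) m s c :
  map_poly f (hankel_solution m s c) = hankel_solution m s (f \o c).
Proof.
rewrite rmorphB [X in _ - X]rmorph_sum /= map_polyC /= -det_map_mx map_hankel;
  congr (_ - _).
apply: eq_bigr => j _; rewrite map_polyZ map_polyXn; congr (_ *: _).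
have := congr1 (fun M : 'cV[B]_m => M j 0) (map_mxM f (\adj (hankel m s c))
  (\col_i c i)).
rewrite mxE => ->; rewrite map_mx_adj map_hankel; congr ((_ *m _) _ _).
by apply/matrixP => k l; rewrite !mxE.
Qed.

(** * General forms *)

Section General.
Variables (K : numClosedFieldType) (d h : nat).
Hypotheses (h_gt1 : (1 < h)%N) (hd : (h <= d <= 2 * h - 1)%N).
(* There are m apolarity conditions on h + 1 = s + m coefficients. *)
Let m := (d - h).+1.
Let s := (2 * h - d)%N.

Let s_gt0 : (0 < s)%N. Proof. by rewrite /s; lia. Qed.
Let sm : (s + m = h.+1)%N. Proof. by rewrite /s /m; lia. Qed.

(** A nonzero maximal minor makes the apolarity conditions independent. *)
Lemma dim_apolar (F : binary_form K d) :
  \det (hankel m s (divided_coef F)) != 0 ->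
  \dim (apolar h F) = (2 * h - d - 1).+1.
Proof.
move=> nz; set H := hankel m s (divided_coef F) in nz *.
have U : H \in unitmx by rewrite unitmxE unitfE.
have full : limg (linfun (@contractions K d h F)) = fullv.
  apply/eqP; rewrite eqEsubv subvf /=; apply/subvP => r _; apply/memv_imgP.
  pose a := invmx H *m r^T.
  pose b l : K := if (l < s)%N then 0 else (rVpoly a^T)`_(l - s).
  exists (bform h b); first exact: memvf.
  rewrite lfunE /=; apply/rowP => i; rewrite mxE /contraction.
  rewrite (eq_bigr (fun j : 'I_h.+1 => b j * divided_coef F (i + j)));
    last first.
    by move=> j _; rewrite form_coef_bform // -ltnS.
  rewrite -sm big_split_ord /= big1 ?add0r => [|j _]; last first.
    by rewrite /b ltn_ord mul0r.
  have /matrixP/(_ i 0) := mulKVmx U r^T; rewrite -/a !mxE => <-.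
  apply: eq_bigr => j _; rewrite /b ltnNge leq_addr /= addKn coef_rVpoly_ord.
  by rewrite !mxE mulrC.
have := limg_ker_dim (linfun (@contractions K d h F)) fullv.
rewrite capfv full dim_binary_form dimvf /dim /= mul1n => E.
by apply: (@addIn (d - h).+1); rewrite [LHS]E; lia.
Qed.

(** At F = x0^d + C(d,h) x0^(d-h) x1^h everything is explicit: the Hankel
    minor is antidiagonal, and with D its value the solution is D (1 - X^h)
    and the associated polynomial is -D X^(h-1). *)
Lemma nondegeneracy_special (c : nat -> K) :
  (forall k, (k <= d)%N -> c k = ((k == 0%N) || (k == h))%:R) ->
  \det (hankel m s c) != 0 /\ nondegeneracy h (hankel_solution m s c) c != 0.
Proof.
move=> cE.
have HE i j : hankel m s c i j = (j == rev_ord i)%:R.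
  rewrite mxE cE; last by have := ltn_ord i; have := ltn_ord j; rewrite /m /s;
    lia.
  congr (_%:R); rewrite -val_eqE /=.
  by have := ltn_ord i; have := ltn_ord j; rewrite /m /s; lia.
have nz : \det (hankel m s c) != 0.
  apply/negP => /det0P [v nz_v v0]; case/eqP: nz_v; apply/rowP => i.
  move/rowP/(_ (rev_ord i)): v0; rewrite !mxE (bigD1 i) //= HE eqxx mulr1 big1.
    by rewrite addr0.
  by move=> k ne; rewrite HE (inj_eq rev_ord_inj) eq_sym (negPf ne) mulr0.
split=> //; set D := \det _ in nz; set g := hankel_solution m s c.
have sg : (size g <= h.+1)%N by rewrite -sm size_hankel_solution.
have g0 : g`_0 = D by rewrite hankel_solution_low.
have gE : g = D%:P - D *: 'X^h.
  (* As c vanishes off 0 and h, the i-th Hankel relation gives the coefficient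
     of degree h - i. *)
  apply/polyP => k; rewrite [RHS]coefB coefC coefZ coefXn.
  case: (ltnP h k) => [lt_hk|le_kh].
    rewrite nth_default ?(leq_trans sg) // (gtn_eqF lt_hk) mulr0 subr0.
    by case: eqP lt_hk => // ->.
  case: (ltnP k s) => [lt_ks|le_sk].
    rewrite hankel_solution_low // -/D [(k == h)]ltn_eqF; last by move: lt_ks;
      rewrite /s; lia.
    by rewrite mulr0 subr0; case: (k == 0%N).
  rewrite [(k == 0%N)]gtn_eqF ?(leq_trans s_gt0) //.
  case: (eqVneq k h) => [->|ne_kh].
    have h_gt0 : (0 < h)%N by lia.
    have := @hankel_solutionP _ m s c ord0 s_gt0;
      rewrite -/g sm big_ord_recr /=.
    rewrite (bigD1 (Ordinal h_gt0)) //= g0 big1 ?addr0 => [|j ne].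
      rewrite !cE ?eqxx ?orbT ?mulr1 ?sub0r //; last by lia.
      by move/eqP; rewrite addrC addr_eq0 => /eqP.
    rewrite -val_eqE /= in ne; have lt_j := ltn_ord j.
    by rewrite cE ?add0n ?(negPf ne) ?ltn_eqF ?mulr0 //; lia.
  have lt_i : (h - k < m)%N by move: le_sk; rewrite /s /m; lia.
  have := @hankel_solutionP _ m s c (Ordinal lt_i) s_gt0; rewrite -/g sm /=.
  have lt_k : (k < h.+1)%N by [].
  rewrite (bigD1 (Ordinal lt_k)) //= subnK // cE ?eqxx ?orbT ?mulr1;
    last by lia.
  rewrite big1 ?addr0 => [->|j ne]; first by rewrite mulr0 subr0.
  rewrite -val_eqE /= in ne; have lt_j := ltn_ord j.
  rewrite cE; last by lia.
  rewrite (_ : _ || _ = false) ?mulr0 //.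
  by move: ne ne_kh; lia.
have gh : g`_h = - D.
  by rewrite gE coefB coefC coefZ coefXn eqxx [h == 0%N]gtn_eqF ?mulr1 ?sub0r
    //; lia.
have sg' : size g = h.+1.
  apply/eqP; rewrite eqn_leq sg /= ltnNge; apply: contraL nz => /leq_sizeP E.
  by rewrite negbK -oppr_eq0 -gh E.
have cop a : a != 0 -> coprimep g (a *: 'X^(h.-1)).
  move=> nz_a; apply: Pdiv.ClosedField.root_coprimep => x gx.
  rewrite hornerZ hornerXn mulf_neq0 // expf_neq0 //.
  apply: contraTneq gx => ->.
  by rewrite /root gE hornerD hornerN hornerC hornerZ hornerXn expr0n gtn_eqF
    ?mulr0 ?subr0 //; lia.
have sX a : (size (a *: 'X^(h.-1) : {poly K}) <= h)%N.
  by apply: (leq_trans (size_scale_leq _ _)); rewrite size_polyXn; lia.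
have nz_h : h%:R != 0 :> K by rewrite pnatr_eq0; lia.
rewrite /nondegeneracy gh !mulf_neq0 ?oppr_eq0 //.
  have -> : g^`() = (- D * h%:R) *: 'X^(h.-1).
    rewrite gE derivB derivC derivZ derivXn sub0r -scaler_nat scalerA.
    by rewrite mulNr scaleNr.
  by apply: sylvester_coprime; rewrite ?sX ?cop ?mulf_neq0 ?oppr_eq0.
have -> : associated h g c = (- D) *: 'X^(h.-1).
  rewrite /associated big_ord_recr /= big1 ?add0r => [|j _].
    have h_gt0 : (0 < h)%N by lia.
    rewrite (bigD1 (Ordinal h_gt0)) //= subn0 big1 ?addr0 => [|a ne].
      by rewrite cE //= mulr1 gh.
    rewrite -val_eqE /= in ne; have := ltn_ord a => lt_a.
    by rewrite cE ?(negPf ne) ?ltn_eqF ?mulr0 ?scale0r //; lia.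
  rewrite big1 // => a _; have lt_a := ltn_ord a; have lt_j := ltn_ord j.
  rewrite gE coefB coefC coefZ coefXn [_ == h]ltn_eqF // mulr0 subr0.
  by rewrite ifF ?mul0r ?scale0r //; lia.
by apply: sylvester_coprime; rewrite ?sX ?cop ?oppr_eq0.
Qed.

Lemma eq_hankel (A : comNzRingType) (c c' : nat -> A) : c =1 c' ->
  hankel m s c = hankel m s c'.
Proof. by move=> E; apply/matrixP => i j; rewrite !mxE. Qed.

Lemma eq_hankel_solution (A : comNzRingType) (c c' : nat -> A) : c =1 c' ->
  hankel_solution m s c = hankel_solution m s c'.
Proof.
move=> E; rewrite /hankel_solution (eq_hankel E); congr (_ - _).
apply: eq_bigr => j _; congr ((_ *m _) _ _ *: _).
by apply/matrixP => k l; rewrite !mxE.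
Qed.

Lemma eq_nondegeneracy (A : comNzRingType) g (c c' : nat -> A) : c =1 c' ->
  nondegeneracy h g c = nondegeneracy h g c'.
Proof.
move=> E; congr (_ * \det (sylvester _ _ _)).
by apply: eq_bigr => j _; apply: eq_bigr => a _; rewrite E.
Qed.

Lemma VSP_isomorphic (F : binary_form K d) :
  \det (hankel m s (divided_coef F)) != 0 ->
  nondegeneracy h (hankel_solution m s (divided_coef F)) (divided_coef F) != 0
    ->
  isomorphic (VSP F h) (proj_space K (2 * h - d - 1)).
Proof.
move=> nzD; set g := hankel_solution _ _ _ => nzg.
apply: (isomorphic_subspace (dim_apolar nzD)) => p.
have le_hd : (h <= d)%N by case/andP: hd.
have sg : (size g <= h.+1)%N by rewrite -sm size_hankel_solution.
pose f0 := bform h (fun j => g`_j).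
have f0E : dehomogenize f0 = g.
  apply/polyP => j; rewrite coef_poly; case: ltnP => [lt_j|ge_j].
    by rewrite form_coef_bform // -ltnS.
  by rewrite nth_default // (leq_trans sg).
apply: (VSP_apolar (ltnW h_gt1) le_hd (f0 := f0)); last by rewrite f0E.
apply/apolarP => // i le_i.
have lt_i : (i < m)%N by rewrite /m; lia.
rewrite -[RHS](@hankel_solutionP _ m s (divided_coef F) (Ordinal lt_i) s_gt0)
  sm.
by apply: eq_bigr => j _; rewrite form_coef_bform // -ltnS.
Qed.

Lemma general_VSP : general (fun F : binary_form K d =>
  isomorphic (VSP F h) (proj_space K (2 * h - d - 1))).
Proof.
pose theta k : {linear binary_form K d -> K^o} :=
  HB.pack (fun F : binary_form K d => divided_coef F k : K^o)
    (GRing.isLinear.Build _ _ _ _ _ (@divided_coef_linear K d k)).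
pose C k := linear_mpoly (theta k).
pose B := \det (hankel m s C) * nondegeneracy h (hankel_solution m s C) C.
have BE F : polyeval B F = \det (hankel m s (divided_coef F)) *
   nondegeneracy h (hankel_solution m s (divided_coef F)) (divided_coef F).
  have E : meval (fun i => coord (vbasis fullv) i F) \o C =1 divided_coef F.
    by move=> k; exact: (polyeval_linear_mpoly (theta k) F).
  rewrite /polyeval rmorphM /= -det_map_mx map_hankel map_nondegeneracy
    map_hankel_solution.
  by rewrite (eq_nondegeneracy _ E) (eq_hankel_solution E) (eq_hankel E).
exists (fun F => polyeval B F = 0); split.
- exists (fun f => f = B) => F; split=> [B0 _ ->|] //; exact.
- pose F0 : binary_form K d :=
    bform d (fun k => ((k == 0%N) || (k == h))%:R * 'C(d, k)%:R).
  exists F0; apply/eqP; rewrite BE.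
  have [|nzD nzg] := @nondegeneracy_special (divided_coef F0);
    last exact: mulf_neq0.
  by move=> k le_k; rewrite /divided_coef form_coef_bform // mulfK // bin_neq0.
move=> F /eqP; rewrite BE mulf_eq0 negb_or => /andP [nzD nzg].
exact: VSP_isomorphic.
Qed.

End General.

Theorem theorem4p1 (R : realType) (h : nat) (h_gt1 : (1 < h)%N) (d : nat)
    (hd : (h <= d <= 2 * h - 1)%N) :
  general (fun F : binary_form R[i] d =>
    isomorphic (VSP F h) (proj_space R[i] (2 * h - d - 1))).
Proof. exact: general_VSP. Qed.
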